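(* Let $n\ge 1$ and let $b=(b_1,\dots,b_n)$ be any sequence of positive integers. The lecture hall polytope $P(b)$ has the Integral Decomposition Property: for any integer $k\ge 0$ and any $p=(x_1,\dots,x_n)\in k\cdot P(b)\cap\mathbb{Z}^n$, there exist $p_1,\dots,p_k\in P(b)\cap\mathbb{Z}^n$ such that $p=p_1+\cdots+p_k$.
   Context: The lecture hall polytope with parameters $b=(b_1,\dots,b_n)$ is $P(b):=\{(x_1,\dots,x_n)\in\mathbb{R}^n : 0\le\frac{x_1}{b_1}\le\cdots\le\frac{x_n}{b_n}\le 1\}$; its dilation $k\cdot P(b)$ is given by the same inequalities with the rightmost $1$ replaced by $k$. *)

(* Defs.v *)
From mathcomp Require Import all_boot all_order all_algebra.
From mathcomp Require Import classical_sets reals.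

Set Implicit Arguments.
Unset Strict Implicit.
Unset Printing Implicit Defensive.

Import Order.TTheory GRing.Theory Num.Theory.
Local Open Scope classical_set_scope.
Local Open Scope ring_scope.

Section LectureHall.
Variables (R : realType) (n : nat).

(* The chain 0 <= x_1/b_1 <= ... <= x_n/b_n <= t; the ordinals of 'I_n are
   enumerated in increasing order. *)
Definition lecture_hall_chain (b : 'I_n -> nat) (t : R) (x : 'rV[R]_n) : bool :=
  path <=%R 0 (rcons [seq x 0 i / (b i)%:R | i : 'I_n] t).

Definition lecture_hall (b : 'I_n -> nat) : set 'rV[R]_n :=
  [set x | lecture_hall_chain b 1 x].

Definition dilate (k : nat) (P : set 'rV[R]_n) : set 'rV[R]_n :=
  [set k%:R *: x | x in P].

Definition integer_points : set 'rV[R]_n :=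
  [set x | x \is a mxOver Num.int].

Definition integral_decomposition_property (P : set 'rV[R]_n) : Prop :=
  forall (k : nat) (p : 'rV[R]_n), (dilate k P `&` integer_points) p ->
  exists q : 'I_k -> 'rV[R]_n,
    (forall i, (P `&` integer_points) (q i)) /\ p = \sum_(i < k) q i.

Lemma lecture_hall_chain_scale (b : 'I_n -> nat) (a t : R) (x : 'rV[R]_n) :
  0 <= a -> lecture_hall_chain b t x -> lecture_hall_chain b (a * t) (a *: x).
Proof.
move=> a0; rewrite /lecture_hall_chain => h.
have -> : rcons [seq (a *: x) 0 i / (b i)%:R | i : 'I_n] (a * t) =
   map ( *%R a) (rcons [seq x 0 i / (b i)%:R | i : 'I_n] t).
  rewrite map_rcons; congr rcons; rewrite /image_mem -map_comp.
  by apply: eq_map => i /=; rewrite mxE mulrA.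
rewrite -[X in path _ X _](mulr0 a) path_map.
by apply: sub_path h => u v /= uv; rewrite ler_wpM2l.
Qed.

Lemma dilate_lecture_hallE (b : 'I_n -> nat) (k : nat) :
  (forall i, 0 < b i)%N ->
  dilate k (lecture_hall b) = [set x | lecture_hall_chain b k%:R x].
Proof.
move=> b0; apply/seteqP; split => [_ [x xP <-]|x /= xP].
  by rewrite /= -[X in lecture_hall_chain _ X _]mulr1;
    apply: lecture_hall_chain_scale.
have [k0|k0] := posnP k; last first.
  have kn0 : k%:R != 0 :> R by rewrite pnatr_eq0 -lt0n.
  exists (k%:R^-1 *: x); last by rewrite scalerA mulfV // scale1r.
  have k1 : k%:R^-1 * k%:R = 1 :> R by rewrite mulVf.
  rewrite /lecture_hall /= -[X in lecture_hall_chain _ X _]k1.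
  by apply: lecture_hall_chain_scale xP; rewrite invr_ge0 ler0n.
exists 0.
  rewrite /lecture_hall /= -(scale0r x) /lecture_hall_chain.
  have /= h := lecture_hall_chain_scale (lexx 0) xP.
  move: h; rewrite /lecture_hall_chain mul0r !rcons_path => /andP[-> /=].
  by move/le_trans; apply; rewrite ler01.
rewrite scaler0; apply/rowP => i; rewrite mxE; apply/esym/eqP.
move: xP; rewrite /lecture_hall_chain k0 => h.
have bi0 : 0 < (b i)%:R :> R by rewrite ltr0n.
have im : x 0 i / (b i)%:R \in [seq x 0 j / (b j)%:R | j : 'I_n].
  by apply/mapP; exists i; rewrite ?mem_enum.
have ge0 : 0 <= x 0 i / (b i)%:R.
  have /allP := order_path_min le_trans h.
  by apply; rewrite mem_rcons inE im orbT.
have le0 : x 0 i / (b i)%:R <= 0.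
  have hs := path_sorted h.
  have : sorted >=%R (rev (rcons [seq x 0 j / (b j)%:R | j : 'I_n] 0)).
    by rewrite rev_sorted.
  rewrite rev_rcons /= (path_sortedE ge_trans) => /andP[/allP + _].
  by apply; rewrite mem_rev.
have : x 0 i / (b i)%:R == 0 by rewrite eq_le le0 ge0.
by rewrite mulf_eq0 invr_eq0 (gt_eqF bi0) orbF.
Qed.

End LectureHall.

Arguments lecture_hall R {n} b.

(* Main.v *)
(** If [y = x_i / b_i] runs over a nondecreasing chain in [0, k + 1], then so do
    [min(y, 1)] in [0, 1] and [max(y - 1, 0)] in [0, k], and the two add up to [y].
    Multiplying back by [b_i], these are [min(x_i, b_i)] and [max(x_i - b_i, 0)], which
    are integers: peeling off the first part, one concludes by induction on [k]. *)
Require Import Defs.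
From mathcomp Require Import all_boot all_order all_algebra.
From mathcomp Require Import classical_sets reals.

Import Order.TTheory GRing.Theory Num.Theory.

Local Open Scope classical_set_scope.
Local Open Scope ring_scope.

(** A monotone [f] preserves every inequality of the chain, and [f 0 = 0] keeps its left end at 0.
    It serves for the two truncations [min(u, 1)] and [max(u - 1, 0)]. *)
Lemma lecture_hall_chain_homo (R : realType) (n : nat) (b : 'I_n -> nat)
    (f : R -> R) (t : R) (x y : 'rV[R]_n) :
  {homo f : u v / (u <= v)} -> f 0 = 0 ->
  (forall i, y 0 i / (b i)%:R = f (x 0 i / (b i)%:R)) ->
  lecture_hall_chain b t x -> lecture_hall_chain b (f t) y.
Proof.
move=> f_homo f0 yE; rewrite /lecture_hall_chain -{2}f0.
have -> : rcons [seq y 0 i / (b i)%:R | i : 'I_n] (f t) =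
    map f (rcons [seq x 0 i / (b i)%:R | i : 'I_n] t).
  rewrite map_rcons; congr rcons; rewrite /image_mem -[RHS]map_comp.
  by apply: eq_map => i; exact: yE.
exact: homo_path.
Qed.

(** Stating membership in the dilate by inequalities lets the induction hypothesis apply to the
    remainder without any rescaling. *)
Lemma lecture_hall_chain_decomp (R : realType) (n : nat) (b : 'I_n -> nat)
    (k : nat) (p : 'rV[R]_n) :
  (forall i, 0 < b i)%N ->
  lecture_hall_chain b k%:R p -> integer_points p ->
  exists q : 'I_k -> 'rV[R]_n,
    (forall i, (lecture_hall R b `&` @integer_points R n) (q i)) /\
    p = \sum_(i < k) q i.
Proof.
move=> b_gt0; have bR_gt0 i : (0 < (b i)%:R :> R) by rewrite ltr0n.
elim: k p => [|k IHk] p p_chain p_int.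
  (* Read as a point of the 0-th dilate, [p] is [0 *: x], hence the empty sum. *)
  have : dilate 0 (lecture_hall R b) p by rewrite dilate_lecture_hallE.
  case=> x _ <-; exists (fun=> 0).
  by split=> [[]//|]; rewrite big_ord0 scale0r.
have {}p_int i : (p 0 i \is a Num.int) by exact: (mxOverP p_int).
pose q0 : 'rV[R]_n := (\row_i Num.min (p 0 i) (b i)%:R).
pose r : 'rV[R]_n := (\row_i Num.max (p 0 i - (b i)%:R) 0).
have q0_chain : lecture_hall_chain b 1 q0.
  have f_homo : {homo (fun u : R => Num.min u 1) : u v / (u <= v)}.
    by move=> u v uv; rewrite le_min !ge_min uv lexx orbT.
  (* The new right end has to be the image of the old one, [k + 1]. *)
  have -> : 1 = Num.min k.+1%:R 1 :> R by rewrite min_r // ler1n.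
  apply: (lecture_hall_chain_homo _ _ _ _ _ _ _ f_homo _ _ p_chain).
    by rewrite min_l // ler01.
  (* Writing 1 as [b_i / b_i] lets the positive factor [1 / b_i] come out of the minimum. *)
  move=> i; rewrite mxE -[X in _ = Num.min _ X](@mulfV _ (b i)%:R) ?gt_eqF //.
  by rewrite minr_pMl // invr_ge0 ltW.
have r_chain : lecture_hall_chain b k%:R r.
  have f_homo : {homo (fun u : R => Num.max (u - 1) 0) : u v / (u <= v)}.
    by move=> u v uv; rewrite ge_max !le_max lerB // lexx orbT.
  have -> : k%:R = Num.max (k.+1%:R - 1) 0 :> R by rewrite -natr1 addrK max_l.
  apply: (lecture_hall_chain_homo _ _ _ _ _ _ _ f_homo _ _ p_chain).
    by rewrite sub0r max_r // oppr_le0 ler01.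
  move=> i; rewrite mxE -[X in _ = Num.max (_ - X) _](@mulfV _ (b i)%:R) ?gt_eqF //.
  rewrite -mulrBl -[X in _ = Num.max _ X](mul0r (b i)%:R^-1).
  by rewrite maxr_pMl // invr_ge0 ltW.
have q0_int : integer_points q0.
  apply/mxOverP => j i; rewrite mxE.
  by case: (leP (p 0 i)) => _; [exact: p_int | exact: rpred_nat].
have r_int : integer_points r.
  apply/mxOverP => j i; rewrite mxE.
  by case: leP => _; rewrite ?rpred0 // rpredB ?rpred_nat.
have [q [qP rE]] := IHk r r_chain r_int.
(* [q0] takes index 0 and the summands of [r] are shifted by one. *)
exists (fun i => if unlift ord0 i is Some j then q j else q0); split.
  by move=> i; case: unliftP => [j|] _; [exact: qP | split].
rewrite big_ord_recl unlift_none; under eq_bigr do rewrite liftK.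
rewrite -rE; apply/rowP => i; rewrite !mxE.
(* What remains is [p_i = min(p_i, b_i) + max(p_i - b_i, 0)]. *)
have [pb|bp] := leP (p 0 i) (b i)%:R.
  by rewrite max_r ?subr_le0 // addr0.
by rewrite max_l ?subr_ge0 ?ltW // addrC subrK.
Qed.

Theorem theorem3p2 (R : realType) (n : nat) (b : 'I_n -> nat)
    (n_ge1 : (1 <= n)%N) (b_gt0 : forall i : 'I_n, (0 < b i)%N) :
  integral_decomposition_property (lecture_hall R b).
Proof.
move=> k p []; rewrite dilate_lecture_hallE //.
exact: lecture_hall_chain_decomp.
Qed.
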